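(* Let $w_p=1$, $w_i=0$ for $i=1,2,\ldots,p-1$, and $\lambda=1$. Then every GOWA robust optimal solution to $\mathcal{P}(\Omega)$ (for these $w$ and $\lambda$) is a min-min robust optimal solution to $\mathcal{P}(\Omega)$, and vice versa.
   Context: Setting: $\Omega=\{\zeta_1,\ldots,\zeta_p\}\subseteq\mathbb{R}^m$ is a finite (ordered) uncertainty set, $\mathcal{X}\subseteq\mathbb{R}^n$ is a compact feasible set independent of $\Omega$, and $f:\mathcal{X}\times\Omega\to\mathbb{R}$ satisfies $f(x,\zeta)\ge 0$ for all $x\in\mathcal{X}$, $\zeta\in\Omega$. The uncertain single objective optimization problem $\mathcal{P}(\Omega)$ is the family of problems $\min_{x\in\mathcal{X}} f(x,\zeta)$, $\zeta\in\Omega$. Auxiliary functions $s_1,\ldots,s_p:\mathcal{X}\to\mathbb{R}$: for each $x$, recursively for $i=1,\ldots,p$, let $j_i(x)$ be the smallest index among those $j\in\{1,\ldots,p\}\setminus\{j_1(x),\ldots,j_{i-1}(x)\}$ at which $f(x,\zeta_j)$ is maximal over that remaining index set, and put $s_i(x)=f(x,\zeta_{j_i(x)})$. Thus exactly one index is removed at each step, so $s_i(x)$ is the $i$-th largest of the values $f(x,\zeta_1),\ldots,f(x,\zeta_p)$ counted with multiplicity. For a real $\lambda>0$ and weights $w_i\ge0$ with $\sum_{i=1}^p w_i=1$, the GOWA robust objective function is $\phi(x)=\left(\sum_{i=1}^{p}w_i(s_i(x))^{\lambda}\right)^{1/\lambda}$, $x\in\mathcal{X}$. A point $\bar x\in\mathcal{X}$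 is a GOWA robust optimal solution to $\mathcal{P}(\Omega)$ if it minimizes $\phi$ over $\mathcal{X}$; it is a min-min robust optimal solution to $\mathcal{P}(\Omega)$ if it minimizes $x\mapsto\min_{\zeta\in\Omega}f(x,\zeta)$ over $\mathcal{X}$. *)

(* Defs.v *)
From HB Require Import structures.
From mathcomp Require Import all_boot all_order all_algebra.
From mathcomp Require Import classical_sets reals topology normedtype exp.

Set Implicit Arguments.
Unset Strict Implicit.
Unset Printing Implicit Defensive.

Import Order.TTheory GRing.Theory Num.Theory.
Import numFieldNormedType.Exports.
Local Open Scope ring_scope.

(* Indices start at 0, and the number of scenarios is p.+1, so that the minimum
   over the scenarios is over a nonempty set; the last index is ord_max. *)

Section SortedValues.
Context {R : realType} {p : nat}.
Implicit Types (v : 'I_p.+1 -> R) (A : {set 'I_p.+1}).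

Definition argmax_set v A : {set 'I_p.+1} :=
  [set j in A | [forall k in A, v k <= v j]].

(* The default ord0 is returned only when A is empty, which does not occur
   for the sets [remaining v k] with k <= p. *)
Definition first_argmax v A : 'I_p.+1 :=
  [arg min_(j < ord0 in argmax_set v A) (j : nat)]%N.

Fixpoint remaining v (k : nat) : {set 'I_p.+1} :=
  if k is k'.+1 then remaining v k' :\ first_argmax v (remaining v k')
  else [set: 'I_p.+1].

Definition sel_index v (i : 'I_p.+1) : 'I_p.+1 :=
  first_argmax v (remaining v i).

Definition sel_value v (i : 'I_p.+1) : R := v (sel_index v i).

End SortedValues.

Section Robustness.
Context {R : realType} {n m p : nat}.
Variables (X : set 'rV[R]_n) (zeta : 'I_p.+1 -> 'rV[R]_m)
  (f : 'rV[R]_n -> 'rV[R]_m -> R).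

Definition minimizes (g : 'rV[R]_n -> R) (xbar : 'rV[R]_n) : Prop :=
  X xbar /\ forall x, X x -> g xbar <= g x.

Definition aux_fun (i : 'I_p.+1) (x : 'rV[R]_n) : R :=
  sel_value (fun j => f x (zeta j)) i.

Definition gowa_objective (w : 'I_p.+1 -> R) (lambda : R) (x : 'rV[R]_n) : R :=
  (\sum_i w i * aux_fun i x `^ lambda) `^ (1 / lambda).

Definition gowa_robust_optimal (w : 'I_p.+1 -> R) (lambda : R)
    (xbar : 'rV[R]_n) : Prop :=
  minimizes (gowa_objective w lambda) xbar.

Definition min_objective (x : 'rV[R]_n) : R :=
  \big[Order.min/f x (zeta ord0)]_i f x (zeta i).

Definition min_min_robust_optimal (xbar : 'rV[R]_n) : Prop :=
  minimizes min_objective xbar.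

End Robustness.

(* Main.v *)
Require Import Defs.
From HB Require Import structures.
From mathcomp Require Import all_boot all_order all_algebra.
From mathcomp Require Import classical_sets reals topology normedtype exp.

(** Removing the index of a maximal value [p] times from [p.+1] indices leaves a
    single index. Every removed index was maximal among those remaining at the
    time, so its value dominates everything that survives it; the survivor
    therefore carries the smallest value. Thus the last sorted value is the
    minimum over the scenarios ([sel_value_ord_max], resting on the two
    invariants [card_remaining] and [remaining_le]). With all the weight on the
    last sorted value and exponent 1, the GOWA objective is that value: the
    power [`^ 1] is the identity on nonnegative reals. The two objectives agree
    on the feasible set, hence have the same minimizers there. *)

Set Implicit Arguments.
Unset Strict Implicit.
Unset Printing Implicit Defensive.

Import Order.TTheory GRing.Theory Num.Theory.
Import numFieldNormedType.Exports.
Local Open Scope ring_scope.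

Section SortedValuesTheory.
Context {R : realType} {p : nat}.
Implicit Types (v : 'I_p.+1 -> R) (A : {set 'I_p.+1}).

Lemma argmax_set_neq0 v A a : a \in A -> exists j, j \in argmax_set v A.
Proof.
move=> aA; case: (arg_maxP v aA) => j jA maxj.
by exists j; rewrite inE; apply/andP; split=> //; apply/forall_inP.
Qed.

(** The usual specification of [arg min] asks that its default value satisfy
    the constraint, whereas here [ord0] need not be a maximizer; any maximizer
    serves to show that the default is never reached. *)
Lemma first_argmax_in_argmax_set v A a :
  a \in A -> first_argmax v A \in argmax_set v A.
Proof.
move=> /(argmax_set_neq0 v)[j jA].
rewrite /first_argmax /arg_min /extremum; case: pickP => [i /andP[]//|none].
case: (arg_minnP (fun i : 'I_p.+1 => i : nat) jA) => i iA mini.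
have /negP[] := negbT (none i).
by apply/andP; split=> //; apply/forall_inP.
Qed.

Lemma first_argmax_in v A a : a \in A -> first_argmax v A \in A.
Proof. by move/(first_argmax_in_argmax_set v); rewrite inE => /andP[]. Qed.

Lemma le_first_argmax v A a : a \in A -> v a <= v (first_argmax v A).
Proof.
move=> aA; move: (first_argmax_in_argmax_set v aA).
by rewrite inE => /andP[_ /forall_inP]; apply.
Qed.

Lemma card_remaining v k : (k <= p.+1)%N -> #|remaining v k| = (p.+1 - k)%N.
Proof.
elim: k => [|k IHk] ltkp /=; first by rewrite cardsT card_ord.
have cardk := IHk (ltnW ltkp).
have /card_gt0P[a ak] : (0 < #|remaining v k|)%N by rewrite cardk subn_gt0.
rewrite subnS -cardk [in RHS](cardsD1 (first_argmax v (remaining v k))).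
by rewrite (first_argmax_in v ak).
Qed.

(** A surviving index was already present when any other index was removed as
    a maximizer. *)
Lemma remaining_le v k i j :
  i \in remaining v k -> j \notin remaining v k -> v i <= v j.
Proof.
elim: k => [|k IHk] /=; first by rewrite !inE.
rewrite !inE negb_and negbK => /andP[_ ik] /orP[/eqP->|]; last exact: IHk.
exact: le_first_argmax.
Qed.

Lemma sel_value_ord_max_le v j : sel_value v ord_max <= v j.
Proof.
have /eqP/cards1P[a rem_a] : #|remaining v p| = 1%N.
  by rewrite card_remaining // subSnn.
have -> : sel_value v ord_max = v a.
  congr v; apply/set1P; rewrite -rem_a; apply: (@first_argmax_in _ _ a).
  by rewrite rem_a set11.
have [-> //|ja] := eqVneq j a.
by apply: (@remaining_le _ p); rewrite rem_a inE.
Qed.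

Lemma sel_value_ord_max v j0 :
  sel_value v ord_max = \big[Order.min/v j0]_i v i.
Proof.
apply/le_anti/andP; split; last exact: bigmin_le.
by apply/le_bigmin => [|i _]; exact: sel_value_ord_max_le.
Qed.

End SortedValuesTheory.

Lemma gowa_objective_last (R : realType) (n m p : nat)
    (zeta : 'I_p.+1 -> 'rV[R]_m) (f : 'rV[R]_n -> 'rV[R]_m -> R)
    (w : 'I_p.+1 -> R) (x : 'rV[R]_n) :
  (forall j, 0 <= f x (zeta j)) -> w ord_max = 1 ->
  (forall i : 'I_p.+1, (i < p)%N -> w i = 0) ->
  gowa_objective zeta f w 1 x = min_objective zeta f x.
Proof.
move=> f_ge0 w_last w_other.
rewrite /gowa_objective big_ord_recr /= big1 => [|i _]; last first.
  by rewrite w_other ?mul0r //=.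
have aux_ge0 : 0 <= aux_fun zeta f ord_max x by exact: f_ge0.
rewrite add0r w_last mul1r divr1 !powRr1 //.
exact: (sel_value_ord_max (fun j => f x (zeta j)) ord0).
Qed.

Lemma eq_minimizes (R : realType) (n : nat) (X : set 'rV[R]_n)
    (g h : 'rV[R]_n -> R) (xbar : 'rV[R]_n) :
  (forall x, X x -> g x = h x) -> minimizes X g xbar <-> minimizes X h xbar.
Proof.
move=> gh; split=> -[Xxbar min_xbar]; split=> // x Xx.
  by rewrite -!gh //; exact: min_xbar.
by rewrite !gh //; exact: min_xbar.
Qed.

Theorem proposition4p6 (R : realType) (n m p : nat)
    (X : set 'rV[R]_n) (zeta : 'I_p.+1 -> 'rV[R]_m)
    (f : 'rV[R]_n -> 'rV[R]_m -> R)
    (X_compact : compact X)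
    (f_ge0 : forall (x : 'rV[R]_n) (j : 'I_p.+1), X x -> 0 <= f x (zeta j))
    (w : 'I_p.+1 -> R) (lambda : R)
    (w_last : w ord_max = 1)
    (w_other : forall i : 'I_p.+1, (i < p)%N -> w i = 0)
    (lambda1 : lambda = 1)
    (xbar : 'rV[R]_n) :
  gowa_robust_optimal X zeta f w lambda xbar <->
  min_min_robust_optimal X zeta f xbar.
Proof.
rewrite lambda1; apply: eq_minimizes => x Xx.
by apply: gowa_objective_last => // j; exact: f_ge0.
Qed.
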